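(* If $G$ is a graph of order $n$ with minimum degree $\delta(G) \ge 3$, then $$\mathrm{pd}_{\frac{7}{8}}(G) \le \frac{1}{3}n.$$
   Context: Graphs are finite, simple and undirected (not necessarily connected); the order of a graph is its number of vertices. For a vertex $v$ of a graph $G$, $N_G[v]$ denotes the closed neighborhood of $v$ ($v$ together with all its neighbors), and for $S \subseteq V(G)$, $N_G[S] = \bigcup_{v\in S} N_G[v]$. For $0 < \alpha \le 1$ and a graph $G$ of order $n$, a set $S \subseteq V(G)$ is an $\alpha$-partial dominating set of $G$ if $|N_G[S]| \ge \alpha \times n$. The $\alpha$-partial domination number $\mathrm{pd}_{\alpha}(G)$ is the minimum cardinality of an $\alpha$-partial dominating set of $G$. *)

(* Defs.v *)
From HB Require Import structures.
From mathcomp Require Import all_boot all_order all_algebra.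

Set Implicit Arguments.
Unset Strict Implicit.
Unset Printing Implicit Defensive.

Import Order.TTheory GRing.Theory Num.Theory.
Local Open Scope ring_scope.

Record sgraph := SGraph {
  vertex :> finType;
  adj : rel vertex;
  adj_sym : symmetric adj;
  adj_irrefl : irreflexive adj
}.

Definition degree (G : sgraph) (v : G) : nat := #|[set w | adj v w]|.

(* Every degree is smaller than #|G|, so the default value #|G| only matters
   for the graph without vertices, where it gives 0. *)
Definition min_degree (G : sgraph) : nat :=
  \big[minn/#|G|]_(v : G) degree v.

Definition closed_nbhd (G : sgraph) (v : G) : {set G} :=
  v |: [set w | adj v w].

Definition closed_nbhd_set (G : sgraph) (S : {set G}) : {set G} :=
  \bigcup_(v in S) closed_nbhd v.

Definition partial_dominating (R : realFieldType) (alpha : R) (G : sgraph)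
    (S : {set G}) : bool :=
  alpha * #|G|%:R <= #|closed_nbhd_set S|%:R.

(* Meaningful for alpha <= 1, when [set: G] is alpha-partial dominating. *)
Definition partial_dom_number (R : realFieldType) (alpha : R) (G : sgraph) :
    nat :=
  #|[arg min_(S < [set: G] | partial_dominating alpha S) #|S| ]|.

Lemma partial_dominating_setT (R : realFieldType) (alpha : R) (G : sgraph) :
  alpha <= 1 -> partial_dominating alpha [set: G].
Proof.
move=> le_alpha1; rewrite /partial_dominating.
have -> : closed_nbhd_set [set: G] = [set: G].
  apply/setP=> v; rewrite inE; apply/bigcupP; exists v; rewrite ?inE //.
  by rewrite eqxx.
by rewrite cardsT -[leRHS]mul1r ler_wpM2r.
Qed.

Lemma partial_dom_numberP (R : realFieldType) (alpha : R) (G : sgraph) :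
    alpha <= 1 ->
  (exists2 S : {set G}, partial_dominating alpha S &
                        #|S| = partial_dom_number alpha G) /\
  (forall S : {set G}, partial_dominating alpha S ->
                       (partial_dom_number alpha G <= #|S|)%N).
Proof.
move=> le_alpha1; rewrite /partial_dom_number.
case: arg_minnP => [|S domS minS]; first exact: partial_dominating_setT.
by split; first exists S.
Qed.

Lemma degree_lt (G : sgraph) (v : G) : (degree v < #|G|)%N.
Proof.
rewrite /degree -cardsT; refine (proper_card _); rewrite properT.
by apply/eqP=> /setP/(_ v); rewrite !inE adj_irrefl.
Qed.

Lemma min_degree_le (G : sgraph) (v : G) : (min_degree G <= degree v)%N.
Proof.
rewrite /min_degree; elim: index_enum (mem_index_enum v) => // w s IHs.
rewrite inE big_cons geq_min => /predU1P[<- | /IHs->]; last exact: orbT.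
by rewrite leqnn.
Qed.

Lemma min_degree_attained (G : sgraph) (v0 : G) :
  exists v : G, degree v = min_degree G.
Proof.
have [v _ minv] := @arg_minnP _ v0 xpredT (@degree G) isT.
exists v; apply/eqP; rewrite eqn_leq min_degree_le andbT /min_degree.
elim/big_ind: _ => [|m n le_m le_n|w _]; first exact/ltnW/degree_lt.
  by rewrite leq_min le_m.
exact: minv.
Qed.

(* Main.v *)
Require Import Defs.
From mathcomp Require Import all_boot all_order all_algebra.
From mathcomp Require Import zify lra.
Import Order.TTheory GRing.Theory Num.Theory.
Local Open Scope ring_scope.

(** Why a third of the vertices suffices.  Let [n] be the order and call the
    gain of a vertex the number of still undominated vertices that it
    dominates.  Each undominated vertex has at least four closed neighbours,
    none of them already chosen; so if [s] vertices are chosen and [u] remain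
    undominated, some vertex has gain at least [4 u / (n - s)] ([exists_gain]).
    This count alone does not guarantee that greedy choice leaves at most [n /
    8] vertices undominated.  The second ingredient is a maximum packing, that
    is, a largest set of vertices with pairwise disjoint closed neighbourhoods.
    If it has [p] vertices, then as long as [u > p] two undominated vertices
    have a common closed neighbour, whence a gain of at least 2
    ([exists_gain_gt_packing]).

    So start from a maximum packing, which dominates at least [4 p] vertices,
    and go on with gains 4, 3, 2 and 1, moving to the next value when the
    inequalities above no longer guarantee the current one.  While gains are at
    least [g] the quantity [g s + u] does not increase ([greedy_phase]), and
    the failure of the guarantee bounds the next such quantity: a linear
    computation shows that, up to rounding, at most [2 n / 21 < n / 8] vertices
    remain undominated after [n / 3] choices, the worst case being [p = n / 7].

    The margin absorbs the rounding of [n / 3] and [n / 8] for all orders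
    ([greedy_budget]) but 5, 7, 11, 14 and 23.  When [n] is odd some vertex has
    degree at least 4 and dominates at least five vertices; starting from it is
    enough for 5, 7, 11 and, when [p] is at most 2, for 23.  For order 14 the
    greedy choice can only fail in a rigid situation, where two chosen vertices
    leave six undominated ones that induce a perfect matching; there a good
    choice of one vertex from each edge of the matching exists because a 2-SAT
    formula with three variables and three clauses of two distinct literals is
    satisfiable ([order14_tight]). *)

(** * Three pairs met by a transversal *)

Section TwoSat.
Local Open Scope nat_scope.

Definition distinct_pairs : seq (nat * nat) :=
  [seq e <- [seq (i, j) | i <- iota 0 6, j <- iota 0 6] | e.1 != e.2].

(** The choice of one element from each of {0, 1}, {2, 3} and {4, 5}. *)
Definition transversal3 (c1 c2 c3 : bool) : seq nat :=
  [:: c1 : nat; 2 + c2; 4 + c3].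

Definition meets (t : seq nat) (e : nat * nat) : bool :=
  (e.1 \in t) || (e.2 \in t).

(** A uniformly random transversal misses a given pair with probability at most
    1/4, so it misses fewer than one of three pairs on average.  The statement
    is finite and is checked by enumeration. *)
Lemma exists_transversal3 e1 e2 e3 :
    e1 \in distinct_pairs -> e2 \in distinct_pairs -> e3 \in distinct_pairs ->
  exists c1 c2 c3, let t := transversal3 c1 c2 c3 in
    [&& meets t e1, meets t e2 & meets t e3].
Proof.
pose bools := [:: false; true].
pose ok e1 e2 e3 := has (fun c1 => has (fun c2 => has (fun c3 =>
  let t := transversal3 c1 c2 c3 in
  [&& meets t e1, meets t e2 & meets t e3]) bools) bools) bools.
have: all (fun e1 => all (fun e2 => all (ok e1 e2) distinct_pairs)
  distinct_pairs) distinct_pairs by vm_compute.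
move=> /allP okP /okP /allP{}okP /okP /allP{}okP /okP.
by case/hasP=> c1 _ /hasP[c2 _ /hasP[c3 _ okc]]; exists c1, c2, c3.
Qed.

End TwoSat.

(** * Gains, degrees and packings *)

Section Greedy.
Local Open Scope nat_scope.
Variable G : sgraph.
Implicit Types (S T U : {set G}) (v w x y z : G).

Definition undominated S : {set G} := ~: closed_nbhd_set S.

Definition gain S v : nat := #|closed_nbhd v :&: undominated S|.

Lemma closed_nbhd_sym v w : (w \in closed_nbhd v) = (v \in closed_nbhd w).
Proof. by rewrite !inE eq_sym adj_sym. Qed.

Lemma closed_nbhd_refl v : v \in closed_nbhd v.
Proof. by rewrite !inE eqxx. Qed.

Lemma card_closed_nbhd v : #|closed_nbhd v| = (degree v).+1.
Proof. by rewrite /closed_nbhd cardsU1 inE adj_irrefl. Qed.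

Lemma undominatedP S v :
  reflect {in S, forall x, v \notin closed_nbhd x} (v \in undominated S).
Proof.
rewrite inE; apply: (iffP idP) => [nv x xS | nv].
  by apply: contra nv => vx; apply/bigcupP; exists x.
by apply/bigcupP => -[x xS]; apply/negP/nv.
Qed.

Lemma undominated_notin S v : v \in undominated S -> v \notin S.
Proof.
by move/undominatedP=> nv; apply/negP => /nv; rewrite closed_nbhd_refl.
Qed.

Lemma card_undominated1 v : #|undominated [set v]| + (degree v).+1 = #|G|.
Proof.
rewrite -card_closed_nbhd /undominated /closed_nbhd_set big_set1.
by rewrite addnC cardsC.
Qed.

Lemma undominatedU1 S z :
  undominated (z |: S) = undominated S :\: closed_nbhd z.
Proof.
by rewrite /undominated /closed_nbhd_set bigcup_setU big_set1 setCU setIC setDE.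
Qed.

Lemma card_undominatedU1 S z :
  #|undominated (z |: S)| + gain S z = #|undominated S|.
Proof. by rewrite undominatedU1 /gain setIC addnC cardsID. Qed.

Lemma gain_mem S z : z \in S -> gain S z = 0.
Proof.
move=> zS; apply/eqP; rewrite cards_eq0 -subset0; apply/subsetP=> x.
by case/setIP=> xz /undominatedP/(_ z zS); rewrite xz.
Qed.

Hypothesis deg3 : forall v, 3 <= degree v.

(** Every undominated vertex is counted once in the gain of each of its at
    least four closed neighbours, and the vertices of [S] have no gain. *)
Lemma sum_gain_ge S : 4 * #|undominated S| <= \sum_(v in ~: S) gain S v.
Proof.
have -> : \sum_(v in ~: S) gain S v = \sum_v gain S v.
  rewrite [RHS](bigID (mem (~: S))) /= [X in _ + X]big1 ?addn0 // => v.
  by rewrite inE negbK; apply: gain_mem.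
have -> : \sum_v gain S v = \sum_(u in undominated S) (degree u).+1.
  under eq_bigr do rewrite /gain -sum1_card.
  rewrite (exchange_big_dep (mem (undominated S))) /=; last first.
    by move=> v u _ /setIP[].
  apply: eq_bigr => u uU; rewrite -card_closed_nbhd -sum1_card.
  by apply: eq_bigl => v; rewrite in_setI uU andbT closed_nbhd_sym.
by rewrite mulnC -sum_nat_const; apply: leq_sum => u _; rewrite ltnS.
Qed.

Lemma exists_gain S d :
  d * (#|G| - #|S|) < 4 * #|undominated S| -> exists z, d < gain S z.
Proof.
move=> lt_d; apply/existsP; rewrite -[X in is_true X]negbK negb_exists.
apply/negP => /forallP max_d; move: lt_d; apply/negP; rewrite -leqNgt.
apply: leq_trans (sum_gain_ge S) _.
rewrite -(cardC (mem S)) addKn mulnC.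
have -> : #|predC (mem S)| = #|~: S| by apply: eq_card => x; rewrite !inE.
by rewrite -sum_nat_const; apply: leq_sum => v _; rewrite leqNgt.
Qed.

Definition packing S : bool :=
  [forall x in S, forall y in S,
     (x != y) ==> [disjoint closed_nbhd x & closed_nbhd y]].

Lemma packingPn S :
  reflect (exists x y z, [/\ x \in S, y \in S, x != y,
             x \in closed_nbhd z & y \in closed_nbhd z]) (~~ packing S).
Proof.
apply: (iffP idP) => [|[x [y [z [xS yS xy xz yz]]]]].
  rewrite negb_forall => /existsP[x]; rewrite negb_imply => /andP[xS].
  rewrite negb_forall => /existsP[y]; rewrite 2!negb_imply => /and3P[yS xy].
  case/pred0Pn=> z /= /andP[zx zy]; exists x, y, z.
  by rewrite !(closed_nbhd_sym z).
apply/negP => /forallP/(_ x)/implyP/(_ xS)/forallP/(_ y)/implyP/(_ yS).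
move/implyP=> /(_ xy) /pred0P /(_ z) /=.
by rewrite -!(closed_nbhd_sym z) xz yz.
Qed.

Lemma card_undominated_packing S :
  packing S -> #|undominated S| + 4 * #|S| <= #|G|.
Proof.
move=> packS; rewrite -(cardsC (closed_nbhd_set S)) addnC leq_add2r.
apply: (@leq_trans (\sum_(x in S) #|closed_nbhd x|)).
  rewrite mulnC -sum_nat_const; apply: leq_sum => x _.
  by rewrite card_closed_nbhd ltnS.
under eq_bigr do rewrite -sum1_card.
rewrite (exchange_big_dep (mem (closed_nbhd_set S))) /=; last first.
  by move=> x v xS vx; apply/bigcupP; exists x.
rewrite -sum1_card; apply: leq_sum => v _; rewrite sum1_card.
apply/card_le1_eqP=> x y /andP[xS vx] /andP[yS vy].
apply/eqP; apply: contraT => xy; have/packingPn := packS; case.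
by exists y, x, v; split; rewrite // closed_nbhd_sym.
Qed.

(** Two vertices of a set that is too large to be a packing share a closed
    neighbour, which dominates both. *)
Lemma exists_gain_gt_packing p S :
    (forall T, packing T -> #|T| <= p) -> p < #|undominated S| ->
  exists z, 1 < gain S z.
Proof.
move=> max_p lt_p.
have /packingPn[x [y [z [xU yU xy xz yz]]]] : ~~ packing (undominated S).
  by apply: contraL lt_p => /max_p; rewrite leqNgt.
exists z; apply/card_gt1P; exists x, y; split=> //; exact/setIP.
Qed.

Lemma exists_maximum_packing :
  exists2 P, packing P & forall T, packing T -> #|T| <= #|P|.
Proof.
have pack0 : packing set0 by apply/forallP=> x; rewrite inE.
have [P packP maxP] := @arg_maxnP _ set0 packing (fun T => #|T|) pack0.
by exists P.
Qed.

(** Every edge is counted from both ends; splitting the neighbours of a vertex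
    according to an arbitrary linear order pairs the two counts off. *)
Lemma sum_degree_even : ~~ odd (\sum_(v : G) degree v).
Proof.
pose r : G -> 'I_#|G| := enum_rank.
have degE v : degree v = \sum_(w | adj v w && (r v < r w)) 1
                       + \sum_(w | adj v w && (r w < r v)) 1.
  rewrite /degree cardsE -sum1_card (bigID (fun w => r v < r w)) /=.
  congr (_ + _); apply: eq_bigl => w; rewrite -[w \in _]/(adj v w) //.
  rewrite -leqNgt leq_eqVlt.
  have [/val_inj/enum_rank_inj-> | _] := eqVneq (r w : nat) (r v); last by [].
  by rewrite adj_irrefl.
under eq_bigr do rewrite degE.
rewrite big_split /= [X in _ + X](exchange_big_dep xpredT) //=.
under [X in _ + X]eq_bigr do under eq_bigl do rewrite adj_sym.
by rewrite addnn odd_double.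
Qed.

Lemma exists_degree_ge4 : odd #|G| -> exists v, 3 < degree v.
Proof.
move=> oddG; apply/existsP; apply: contraT; rewrite negb_exists.
move=> /forallP deg_le; have := sum_degree_even; move/negP; case.
have deg v : degree v = 3 by have := deg_le v; have := deg3 v; lia.
by under eq_bigr do rewrite deg; rewrite sum_nat_const oddM oddG.
Qed.

(** * The greedy choice *)

(** Adding vertices of gain at least [g] does not increase [g * #|S| +
    #|undominated S|], and can only go on as long as some vertices remain
    undominated. *)
Lemma greedy_phase (continue : nat -> nat -> bool) g k S :
    0 < g -> #|S| <= k ->
    (forall T, continue #|T| #|undominated T| -> exists z, g <= gain T z) ->
  exists S', [/\ #|S| <= #|S'|, #|S'| <= k,
    g * #|S'| + #|undominated S'| <= g * #|S| + #|undominated S| &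
    (#|S'| < k) ==> ~~ continue #|S'| #|undominated S'|].
Proof.
move=> g_gt0 + gainP; have [m] := ubnP #|undominated S|.
elim: m S => // m IHm S lt_m le_k.
have [|stop] := boolP ((#|S| < k) && continue #|S| #|undominated S|);
  last first.
  by exists S; split=> //; rewrite implybE -negb_and.
case/andP=> lt_k /gainP[z le_g].
have zS : z \notin S by apply: contraTN le_g => /gain_mem->; rewrite -ltnNge.
have card_zS : #|z |: S| = #|S|.+1 by rewrite cardsU1 zS.
have uU := card_undominatedU1 S z.
have [||S' [lb ub pot stop]] := IHm (z |: S); [lia | by rewrite card_zS | ].
exists S'; split=> //; rewrite ?card_zS in lb pot; lia.
Qed.

(** The pairs [(si, ui)] record the numbers of chosen and of undominated
    vertices: [i = 0] is the start, and [i = 1, 2, 3, 4] are the ends of the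
    phases with gains 4, 3, 2 and 1.  With [v := 2 * s2 + u2], the ends of the
    first two phases, unless [k] vertices are chosen by then, give [13 * (3 *
    s1 + u1) <= 12 * n] and [5 * v <= n + 3 * (3 * s2 + u2)], while a start
    from the packing gives [3 * s1 + u1 <= n - p].  The third phase ends either
    with [s3 = k], so that [u3 <= v - 2 * k], or with [u3 <= p], so that [2 *
    (s3 + u3) <= v + p].  Here [e = 1] says that the start is one vertex better
    than four new vertices per choice, which is what the listed small orders
    need. *)
Lemma greedy_budget n k p e s0 u0 s1 u1 s2 u2 s3 u3 s4 u4 :
    4 <= n -> n <> 14 -> 3 * k <= n < 3 * k + 3 -> 4 * p <= n ->
    4 * s0 + u0 + e <= n ->
    [|| (e == 0) && (p <= s0) && (n \notin [:: 5; 7; 11]) &&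
         ((n == 23) ==> (2 < p)),
        (e == 1) && (n \in [:: 5; 7; 11]) |
        (e == 1) && (n == 23) && (p <= 2)] ->
    s0 <= s1 -> s1 <= k -> 4 * s1 + u1 <= 4 * s0 + u0 ->
    (s1 < k) ==> ~~ (3 * (n - s1) < 4 * u1) ->
    s1 <= s2 -> s2 <= k -> 3 * s2 + u2 <= 3 * s1 + u1 ->
    (s2 < k) ==> ~~ (2 * (n - s2) < 4 * u2) ->
    s2 <= s3 -> s3 <= k -> 2 * s3 + u3 <= 2 * s2 + u2 ->
    (s3 < k) ==> ~~ (p < u3) ->
    s3 <= s4 -> s4 <= k -> 1 * s4 + u4 <= 1 * s3 + u3 ->
    (s4 < k) ==> ~~ (0 < u4) ->
  8 * u4 <= n.
Proof.
rewrite !inE => n4 n14 kE p_le start startP.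
lia.
Qed.

(** * Order 14 *)

Lemma greedy_step S d : d * (#|G| - #|S|) < 4 * #|undominated S| ->
  exists S', #|S'| = #|S|.+1 /\ #|undominated S'| + d < #|undominated S|.
Proof.
move=> /exists_gain[z lt_d]; exists (z |: S).
have zS : z \notin S by apply: contraTN lt_d => /gain_mem->.
by rewrite cardsU1 zS; split=> //; have := card_undominatedU1 S z; lia.
Qed.

(** The only way in which greedy choice can fail for order 14.  The hypothesis
    on gains says that each of the six undominated vertices has exactly one
    undominated neighbour, and each dominated vertex other than [a] and [b]
    exactly two.  Keep [a], drop [b], and take one end of each edge of the
    matching on the undominated vertices: this dominates those six vertices and
    [closed_nbhd a].  At most four vertices remain, and those other than [b]
    have two neighbours among the six.  Giving up one of the four, [b] if it is
    there, the ends can be chosen so as to meet the pairs of neighbours of the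
    others. *)
Lemma order14_tight a b :
    #|G| = 14 -> #|undominated [set a; b]| = 6 ->
    {in ~: [set a; b], forall v, gain [set a; b] v = 2} ->
  exists2 S : {set G}, #|S| <= 4 & #|undominated S| <= 1.
Proof.
move=> cardG; set U := undominated _ => cardU gain2.
(* For [w] in [U], this is the edge of the matching that contains [w]. *)
pose B w := closed_nbhd w :&: U.
have cardB w : w \in U -> #|B w| = 2.
  by move=> wU; apply: gain2; rewrite in_setC undominated_notin.
have memB w : w \in U -> w \in B w.
  by move=> wU; rewrite in_setI closed_nbhd_refl.
have B_eq w z : w \in U -> z \in B w -> B z = B w.
  move=> wU zB; have [-> // | zw] := eqVneq z w.
  have zU : z \in U by case/setIP: zB.
  have wBz : w \in B z.
    by rewrite in_setI wU closed_nbhd_sym andbT; case/setIP: zB.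
  have E x : x \in U -> w \in B x -> z \in B x -> B x = [set w; z].
    move=> xU wx zx; apply/esym/eqP; rewrite eqEcard subUset !sub1set wx zx.
    by rewrite cardB // cards2 eq_sym zw.
  by rewrite E ?memB // [RHS]E ?memB.
have B_disj w z : w \in U -> z \in U -> z \notin B w -> B z :&: B w = set0.
  move=> wU zU; apply: contraNeq => /set0Pn[x /setIP[xz xw]].
  by rewrite -(B_eq _ _ wU xw) (B_eq _ _ zU xz) memB.
have BU w : B w \subset U by apply: subsetIr.
have cardD w (V : {set G}) :
    B w \subset V -> w \in U -> #|V :\: B w| = #|V| - 2.
  by move=> sB wU; rewrite cardsD (setIidPr sB) cardB.
have [w1 w1U] : exists w, w \in U by apply/card_gt0P; rewrite cardU.
have cardU1 := cardD w1 U (BU w1) w1U.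
have [w2 w2U1] : exists w, w \in U :\: B w1.
  by apply/card_gt0P; rewrite cardU1 cardU.
have /setDP[w2U w2B1] := w2U1.
have B2 : B w2 \subset U :\: B w1 by rewrite subsetD BU -setI_eq0 B_disj ?eqxx.
have cardU2 := cardD w2 _ B2 w2U.
have [w3 w3U2] : exists w, w \in (U :\: B w1) :\: B w2.
  by apply/card_gt0P; rewrite cardU2 cardU1 cardU.
have /setDP[/setDP[w3U w3B1] w3B2] := w3U2.
have B3 : B w3 = (U :\: B w1) :\: B w2.
  apply/eqP; rewrite eqEcard cardU2 cardU1 cardU cardB // andbT.
  by rewrite !subsetD BU -!setI_eq0 !B_disj ?eqxx.
have UE x : x \in U -> [\/ x \in B w1, x \in B w2 | x \in B w3].
  move=> xU; have [|x1] := boolP (x \in B w1); first by constructor 1.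
  have [|x2] := boolP (x \in B w2); first by constructor 2.
  by constructor 3; rewrite B3 !in_setD x1 x2.
have /eqP/cards2P[p1 [q1 [_ E1]]] := cardB _ w1U.
have /eqP/cards2P[p2 [q2 [_ E2]]] := cardB _ w2U.
have /eqP/cards2P[p3 [q3 [_ E3]]] := cardB _ w3U.
pose us := [:: p1; q1; p2; q2; p3; q3].
have usU x : x \in U -> exists2 i, i \in iota 0 6 & nth a us i = x.
  case/UE; rewrite ?E1 ?E2 ?E3 => /set2P[] ->.
  - by exists 0.
  - by exists 1.
  - by exists 2.
  - by exists 3.
  - by exists 4.
  - by exists 5.
pose Y := ~: (closed_nbhd a :|: U).
have cardY : #|Y| <= 4.
  have dis : closed_nbhd a :&: U = set0.
    apply/setP=> x; rewrite in_setI in_set0; apply/andP=> -[xa].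
    by move/undominatedP/(_ a); rewrite xa set21 => /(_ isT).
  have := cardsC (closed_nbhd a :|: U); rewrite cardsU dis cards0 cardU.
  rewrite card_closed_nbhd -/Y cardG; have := deg3 a.
  by move: #|Y| (degree a); clear; lia.
(* [e] is the vertex that may stay undominated; it has to be [b] when [b] is
   not dominated by [a], as [b] has no neighbour in [U]. *)
have [e [cardYe bYe]] : exists e, #|Y :\ e| <= 3 /\ b \notin Y :\ e.
  have [bY | bY] := boolP (b \in Y).
    by exists b; rewrite setD11; move: cardY; rewrite (cardsD1 b) bY.
  have [Y0 | [e eY]] := set_0Vmem Y.
    by exists b; rewrite Y0 set0D cards0 in_set0.
  exists e; rewrite in_setD1 (negbTE bY) andbF.
  by move: cardY; rewrite (cardsD1 e) eY.
(* Two distinct positions in [us] of neighbours of [y]. *)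
pose Q y (f : nat * nat) :=
  (nth a us f.1 \in closed_nbhd y) && (nth a us f.2 \in closed_nbhd y).
pose f y := head (0, 1) [seq f <- distinct_pairs | Q y f].
have f_pair y : f y \in distinct_pairs.
  rewrite /f; case E : [seq _ <- _ | _] => [//|g gs] /=.
  by have := mem_head g gs; rewrite -E mem_filter => /andP[].
have f_nbr y : y \in Y :\ e -> Q y (f y).
  move=> yY; have yab : y \notin [set a; b].
    apply: contraL yY => /set2P[] -> //.
    by rewrite in_setD1 in_setC in_setU closed_nbhd_refl andbF.
  have /eqP/cards2P[p [q [pq Bpq]]] : #|closed_nbhd y :&: U| = 2.
    by apply: gain2; rewrite in_setC.
  have /setIP[py /usU[i i6 pE]] : p \in closed_nbhd y :&: U.
    by rewrite Bpq set21.
  have /setIP[qy /usU[j j6 qE]] : q \in closed_nbhd y :&: U.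
    by rewrite Bpq set22.
  have : (i, j) \in [seq g <- distinct_pairs | Q y g].
    rewrite mem_filter /Q pE qE py qy mem_filter allpairs_f //= andbT.
    by apply: contra_neq pq => ij; rewrite -pE -qE ij.
  rewrite /f; case E : [seq _ <- _ | _] => [//|g gs] _ /=.
  by have := mem_head g gs; rewrite -E mem_filter => /andP[].
pose ys := enum (Y :\ e).
have [c1 [c2 [c3 /and3P[hit0 hit1 hit2]]]] := exists_transversal3 _ _ _
  (f_pair (nth a ys 0)) (f_pair (nth a ys 1)) (f_pair (nth a ys 2)).
pose x1 := nth a us c1; pose x2 := nth a us (2 + c2).
pose x3 := nth a us (4 + c3).
have x1B : x1 \in B w1 by rewrite E1 /x1; case: (c1); rewrite !inE eqxx ?orbT.
have x2B : x2 \in B w2 by rewrite E2 /x2; case: (c2); rewrite !inE eqxx ?orbT.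
have x3B : x3 \in B w3 by rewrite E3 /x3; case: (c3); rewrite !inE eqxx ?orbT.
exists [set a; x1; x2; x3].
  have card_add1 (V : {set G}) x : #|V :|: [set x]| <= #|V|.+1.
    by rewrite setUC cardsU1; case: (_ \notin _).
  rewrite (leq_trans (card_add1 _ _)) // ltnS.
  rewrite (leq_trans (card_add1 _ _)) // ltnS cards2.
  by case: (_ != _).
rewrite -(cards1 e); apply/subset_leq_card/subsetP=> x /undominatedP xS.
have xa : x \notin closed_nbhd a by apply: xS; rewrite !inE eqxx.
have xx1 : x \notin closed_nbhd x1 by apply: xS; rewrite !inE eqxx ?orbT.
have xx2 : x \notin closed_nbhd x2 by apply: xS; rewrite !inE eqxx ?orbT.
have xx3 : x \notin closed_nbhd x3 by apply: xS; rewrite !inE eqxx ?orbT.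
have xU : x \notin U.
  apply/negP=> /UE[]; rewrite -?(B_eq _ _ w1U x1B) -?(B_eq _ _ w2U x2B)
    -?(B_eq _ _ w3U x3B) in_setI ?(negbTE xx1) ?(negbTE xx2) ?(negbTE xx3) //.
rewrite in_set1; apply: contraT => xe.
have xY : x \in Y :\ e by rewrite in_setD1 xe in_setC in_setU negb_or xa.
have miss i : i \in transversal3 c1 c2 c3 -> nth a us i \notin closed_nbhd x.
  by rewrite closed_nbhd_sym !in_cons in_nil orbF => /or3P[] /eqP->.
have no_hit : ~~ meets (transversal3 c1 c2 c3) (f x).
  have /andP[n1 n2] := f_nbr x xY.
  rewrite negb_or; apply/andP; split; first by apply: contraL n1; apply: miss.
  by apply: contraL n2; apply: miss.
have ltx : index x ys < 3.
  by apply: leq_trans cardYe; rewrite cardE index_mem mem_enum.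
have xE : nth a ys (index x ys) = x by rewrite nth_index ?mem_enum.
move: no_hit; rewrite -xE; case: (index x ys) ltx => [|[|[|]]] // _.
- by rewrite hit0.
- by rewrite hit1.
- by rewrite hit2.
Qed.

Lemma order14 :
  #|G| = 14 -> exists2 S : {set G}, #|S| <= 4 & #|undominated S| <= 1.
Proof.
move=> cardG.
(* It suffices to reach three chosen and at most three undominated vertices,
   because [1 * (14 - 3) < 4 * 3]. *)
have end3 S : #|S| = 3 -> #|undominated S| <= 3 ->
    exists2 S : {set G}, #|S| <= 4 & #|undominated S| <= 1.
  move=> cardS u3; have [u1 | u1] := leqP #|undominated S| 1.
    by exists S; rewrite ?cardS.
  have [|S' [cardS' u']] := greedy_step S (#|undominated S| - 2).
    by rewrite cardG cardS; lia.
  by exists S'; lia.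
have [v _] : exists v, v \in G by apply/card_gt0P; rewrite cardG.
have := card_undominated1 v; have := deg3 v; rewrite cardG.
set S1 := [set v] => dv u1.
have cardS1 : #|S1| = 1 by rewrite cards1.
have [u1le | u1gt] := leqP #|undominated S1| 1.
  by exists S1; rewrite ?cardS1.
have [|S2 [cardS2 u2]] := greedy_step S1 (#|undominated S1| - 7).
  by rewrite cardG cardS1; lia.
rewrite cardS1 in cardS2.
have {u2} u2 : #|undominated S2| <= 6 by lia.
have [u2le | u2gt] := leqP #|undominated S2| 1.
  by exists S2; rewrite ?cardS2.
have [/existsP[z gz] | ] := boolP [exists z, 2 < gain S2 z].
  apply: (end3 (z |: S2)); last by have := card_undominatedU1 S2 z; lia.
  rewrite cardsU1 cardS2 (contraTN _ gz) // => /gain_mem->//.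
rewrite negb_exists => /forallP gain_le.
(* The guaranteed gain is 2 as soon as four vertices are undominated, and 1
   otherwise. *)
have [u5 | u6] := leqP #|undominated S2| 5.
  have [|S3 [cardS3 u3]] := greedy_step S2 (3 < #|undominated S2|).
    by rewrite cardG cardS2; lia.
  by apply: (end3 S3); lia.
have {u2 u6} u6 : #|undominated S2| = 6 by lia.
have cardCS2 : #|~: S2| = 12 by have := cardsC S2; lia.
(* The twelve gains are at most 2 and add up to at least [4 * 6]. *)
have gain2 : {in ~: S2, forall w, gain S2 w = 2}.
  move=> w wS; apply/eqP; rewrite eqn_leq leqNgt gain_le /= leqNgt.
  apply/negP=> gw; have := sum_gain_ge S2; rewrite u6 (big_setD1 w) //=.
  have : \sum_(x in ~: S2 :\ w) gain S2 x <= \sum_(x in ~: S2 :\ w) 2.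
    by apply: leq_sum => x _; rewrite leqNgt.
  rewrite sum_nat_const; have := cardsD1 w (~: S2); rewrite wS cardCS2.
  lia.
have /eqP/cards2P[a [b [_ S2E]]] := cardS2.
by apply: (order14_tight a b); rewrite // -S2E.
Qed.

(** * The bound *)

Lemma exists_seven_eighths :
  0 < #|G| ->
  exists2 S : {set G}, 3 * #|S| <= #|G| & 8 * #|undominated S| <= #|G|.
Proof.
case/card_gt0P=> v0 _.
have cardG4 : 4 <= #|G| by have := card_undominated1 v0; have := deg3 v0; lia.
have [cardG | cardG] := eqVneq #|G| 14.
  by have [S cS uS] := order14 cardG; exists S; rewrite cardG; lia.
have [P packP maxP] := exists_maximum_packing.
have cP := card_undominated_packing P packP.
have kE : 3 * (#|G| %/ 3) <= #|G| < 3 * (#|G| %/ 3) + 3 by lia.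
have [S0 [e [s0k start startP]]] : exists S0 e, [/\ #|S0| <= #|G| %/ 3,
    4 * #|S0| + #|undominated S0| + e <= #|G| &
    [|| (e == 0) && (#|P| <= #|S0|) && (#|G| \notin [:: 5; 7; 11]) &&
         ((#|G| == 23) ==> (2 < #|P|)),
        (e == 1) && (#|G| \in [:: 5; 7; 11]) |
        (e == 1) && (#|G| == 23) && (#|P| <= 2)]].
  have [small | large] := boolP ((#|G| \in [:: 5; 7; 11]) ||
                                 (#|G| == 23) && (#|P| <= 2)).
    have [|v dv] := exists_degree_ge4.
      by case/orP: small; rewrite ?inE; lia.
    exists [set v], 1; rewrite cards1.
    by have := card_undominated1 v; split; [lia | lia | rewrite -andbA].
  exists P, 0; split; [lia | lia | rewrite !inE in large *; lia].
(* In turn, gains of at least 4, 3, 2 and 1. *)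
have [|S1 [lb1 ub1 pot1 stop1]] :=
  greedy_phase (fun s u => 3 * (#|G| - s) < 4 * u) 4 _ S0 isT s0k.
  by move=> T; apply: exists_gain.
have [|S2 [lb2 ub2 pot2 stop2]] :=
  greedy_phase (fun s u => 2 * (#|G| - s) < 4 * u) 3 _ S1 isT ub1.
  by move=> T; apply: exists_gain.
have [|S3 [lb3 ub3 pot3 stop3]] :=
  greedy_phase (fun s u => #|P| < u) 2 _ S2 isT ub2.
  by move=> T; apply: exists_gain_gt_packing.
have [|S4 [lb4 ub4 pot4 stop4]] :=
  greedy_phase (fun s u => 0 < u) 1 _ S3 isT ub3.
  by move=> T uT; apply: exists_gain; rewrite mul0n; lia.
exists S4; first lia.
have := greedy_budget _ _ _ _ _ _ _ _ _ _ _ _ _ _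
  cardG4 (elimN eqP cardG) kE _ start startP
  lb1 ub1 pot1 stop1 lb2 ub2 pot2 stop2 lb3 ub3 pot3 stop3 lb4 ub4 pot4 stop4.
by apply; lia.
Qed.

End Greedy.

Theorem theorem4p2 (R : realFieldType) (G : sgraph) (n : nat)
    (card_G : #|G| = n) (min_deg_G : (3 <= min_degree G)%N) :
  (partial_dom_number (7%:R / 8%:R : R) G)%:R <= (1 / 3%:R) * n%:R :> R.
Proof.
have deg3 (v : G) : (3 <= degree v)%N.
  exact: leq_trans min_deg_G (min_degree_le v).
have G_gt0 : (0 < #|G|)%N.
  case: (posnP #|G|) min_deg_G => // G0; rewrite /min_degree big_pred0 ?G0 //.
  by move=> v; have := fintype0 v G0.
have [S cardS uS] := exists_seven_eighths G deg3 G_gt0.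
have le1 : 7%:R / 8%:R <= 1 :> R by lra.
have [_ /(_ S) minS] := partial_dom_numberP G le1.
have {}minS : (partial_dom_number (7%:R / 8%:R : R) G <= #|S|)%N.
  apply: minS.
  rewrite /partial_dominating -(cardsC (closed_nbhd_set S)).
  rewrite natrD; move: uS; rewrite -(cardsC (closed_nbhd_set S)).
  by rewrite -/(undominated G S) -(ler_nat R) natrM natrD; lra.
have : (3 * partial_dom_number (7%:R / 8%:R : R) G <= n)%N.
  by rewrite -card_G; lia.
rewrite -(ler_nat R) natrM; lra.
Qed.
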